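(* Let $\psi$ denote the digamma function and $\gamma$ the Euler–Mascheroni constant. The function $$q(t) := t^{\,t(\psi(t)-\log t)-\gamma}$$ is logarithmically completely monotonic on $(0,1)$.
   Context: The gamma function is $\Gamma(x)=\int_0^\infty t^{x-1}e^{-t}\,dt$ for $x>0$, and the digamma function is $\psi(x)=\Gamma'(x)/\Gamma(x)$ for $x>0$. The symbol $\gamma$ denotes the Euler–Mascheroni constant, and $\log=\ln$ is the natural logarithm. A positive function $f$ on an open interval $I$ is called logarithmically completely monotonic on $I$ if (it has derivatives of all orders on $I$ and) $(-1)^n[\ln f(x)]^{(n)}\ge 0$ for all $x\in I$ and all $n=1,2,\ldots$. *)

(* Defs.v *)
From Stdlib Require Import Reals.
From Coquelicot Require Import Coquelicot.
Open Scope R_scope.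

(* The improper integral is taken at both ends, since the integrand is
   unbounded near 0 when x < 1. Only the values at x > 0 are meaningful. *)
Definition Gamma (x : R) : R :=
  RInt_gen (fun t => Rpower t (x - 1) * exp (- t))
    (at_right 0) (Rbar_locally p_infty).

Definition digamma (x : R) : R := Derive Gamma x / Gamma x.

Definition euler_gamma : R :=
  real (Lim_seq (fun n => sum_n_m (fun k => / INR k) 1 n - ln (INR n))).

Definition in_open_interval (a b : Rbar) (x : R) : Prop :=
  Rbar_lt a (Finite x) /\ Rbar_lt (Finite x) b.

Definition log_completely_monotonic (f : R -> R) (a b : Rbar) : Prop :=
  (forall x, in_open_interval a b x -> 0 < f x) /\
  (forall n x, in_open_interval a b x -> ex_derive_n f n x) /\
  (forall n x, (1 <= n)%nat -> in_open_interval a b x ->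
     0 <= (-1) ^ n * Derive_n (fun y => ln (f y)) n x).

Definition q (t : R) : R :=
  Rpower t (t * (digamma t - ln t) - euler_gamma).

(* Main.v *)
(* With [h t = t (ln t - digamma t)] one has [ln (q t) = (euler_gamma + h t) (- ln t)] on (0,1).
   Completely monotonic functions are closed under sums, products, exponentials and pointwise
   limits, and [euler_gamma >= 0], so it suffices that [h] is completely monotonic on (0,oo).
   By [digamma (t + 1) = digamma t + 1/t], the second difference of [h] is an elementary
   function whose second derivative is [2 / (t (t + 1)^3 (t + 2))], hence it is completely
   monotonic. Since [h (t + k)] tends to 1/2, summing differences twice exhibits [h] as a limit
   of completely monotonic functions.
   The facts on [digamma] come from the Bohr-Mollerup argument: [ln Gamma] is convex and
   [Gamma (x + 1) = x Gamma x], so [ln Gamma] is the limit of Euler's products, and this limit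
   can be differentiated because the second derivatives are locally bounded. *)

Require Import Defs.
From Stdlib Require Import Reals Lra Lia.
From Coquelicot Require Import Coquelicot.
Open Scope R_scope.

(** * Completely monotonic functions *)

(* Uniformly bounded second derivatives give a uniform Taylor estimate, which passes to
   pointwise limits. *)
Lemma derivative_of_limit (u u1 u2 : nat -> R -> R) (f : R -> R) (x d M : R) :
  0 < d ->
  (forall n y, Rabs (y - x) <= d -> is_derive (u n) y (u1 n y)) ->
  (forall n y, Rabs (y - x) <= d -> is_derive (u1 n) y (u2 n y)) ->
  (forall n y, Rabs (y - x) <= d -> Rabs (u2 n y) <= M) ->
  (forall y, Rabs (y - x) <= d -> is_lim_seq (fun n => u n y) (f y)) ->
  exists l : R, is_lim_seq (fun n => u1 n x) l /\ is_derive f x l.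
Proof.
  intros Hd Hu Hu1 HM Hf.
  assert (Hx : Rabs (x - x) <= d) by (rewrite Rminus_diag, Rabs_R0; lra).
  assert (HM0 : 0 <= M) by (eapply Rle_trans; [apply Rabs_pos | apply (HM 0%nat x Hx)]).
  (* Two mean value steps: [c] lies between [x] and [y], so [u1 n c - u1 n x] is at most
     [M * Rabs (y - x)]. *)
  assert (Taylor : forall n y, Rabs (y - x) <= d ->
    Rabs (u n y - u n x - u1 n x * (y - x)) <= M * (y - x) ^ 2).
  { intros n y Hy.
    destruct (MVT_cor4 (u n) (u1 n) x d (Hu n) y Hy) as [c [Ec Hc]].
    destruct (MVT_cor4 (u1 n) (u2 n) x d (Hu1 n) c ltac:(lra)) as [e [Ee He]].
    replace (u n y - u n x - u1 n x * (y - x))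
      with ((u2 n e * (c - x)) * (y - x)) by (rewrite Ec, <- Ee; ring).
    rewrite !Rabs_mult, <- (pow2_abs (y - x)).
    assert (Rabs (u2 n e) * Rabs (c - x) <= M * Rabs (y - x)).
    { apply Rmult_le_compat; try apply Rabs_pos; [apply HM; lra | exact Hc]. }
    assert (H0 := Rabs_pos (y - x)). nra. }
  assert (Hc : ex_lim_seq_cauchy (fun n => u1 n x)).
  { intros eps. assert (He := cond_pos eps).
    (* Each [u1 n x] is compared with the difference quotient of [u n] over a step [s]. The two
       Taylor errors cost at most [M * s <= eps / 4] each; the values at [x] and [x + s], Cauchy
       within [eps * s / 8], cost [eps / 8] each after division by [s]. Using [M + 1] covers
       [M = 0]. *)
    set (s := Rmin d (eps / (4 * (M + 1)))).
    assert (Hs : 0 < s).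
    { apply Rmin_pos; [lra|]. apply Rdiv_lt_0_compat; lra. }
    assert (Hsd : s <= d) by apply Rmin_l.
    assert (HMs : M * s <= eps / 4).
    { apply Rle_trans with (M * (eps / (4 * (M + 1)))).
      - apply Rmult_le_compat_l; [lra | apply Rmin_r].
      - apply (Rmult_le_reg_r (4 * (M + 1))); [lra|].
        replace (M * (eps / (4 * (M + 1))) * (4 * (M + 1))) with (M * eps) by (field; lra).
        nra. }
    assert (Hy : Rabs (x + s - x) <= d).
    { replace (x + s - x) with s by ring. rewrite Rabs_pos_eq; lra. }
    assert (Hes : 0 < eps * s / 8) by nra.
    assert (C1 := proj1 (ex_lim_seq_cauchy_corr _) (ex_intro _ (f x) (Hf x Hx))
                    (mkposreal _ Hes)).
    assert (C2 := proj1 (ex_lim_seq_cauchy_corr _) (ex_intro _ (f (x + s)) (Hf _ Hy))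
                    (mkposreal _ Hes)).
    destruct C1 as [N1 C1], C2 as [N2 C2]; simpl in C1, C2.
    exists (N1 + N2)%nat. intros n m Hn Hm.
    specialize (C1 n m ltac:(lia) ltac:(lia)). specialize (C2 n m ltac:(lia) ltac:(lia)).
    assert (T1 := Taylor n _ Hy). assert (T2 := Taylor m _ Hy).
    replace (x + s - x) with s in T1, T2 by ring.
    assert (HM2 : M * s ^ 2 <= eps / 4 * s) by nra.
    apply Rabs_def2 in C1, C2. apply Rabs_le_between in T1, T2.
    apply Rabs_def1; apply (Rmult_lt_reg_r s); try lra; nra. }
  destruct (proj2 (ex_lim_seq_cauchy_corr _) Hc) as [l Hl].
  exists l; split; [exact Hl|].
  assert (TaylorL : forall y, Rabs (y - x) <= d ->
    Rabs (f y - f x - l * (y - x)) <= M * (y - x) ^ 2).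
  { intros y Hy.
    apply (is_lim_seq_le (fun n => Rabs (u n y - u n x - u1 n x * (y - x)))
             (fun _ => M * (y - x) ^ 2)
             (Rabs (f y - f x - l * (y - x))) (M * (y - x) ^ 2)).
    - intros n; apply Taylor, Hy.
    - apply (is_lim_seq_abs _ (Finite _)).
      apply is_lim_seq_minus'; [apply is_lim_seq_minus'; apply Hf; assumption|].
      apply is_lim_seq_mult'; [exact Hl | apply is_lim_seq_const].
    - apply is_lim_seq_const. }
  apply is_derive_Reals. intros eps He.
  assert (Hdel : 0 < Rmin d (eps / (M + 1))).
  { apply Rmin_pos; [lra|]. apply Rdiv_lt_0_compat; lra. }
  exists (mkposreal _ Hdel). simpl. intros h Hh0 Hh.
  assert (Hh1 : Rabs h < d) by (eapply Rlt_le_trans; [exact Hh | apply Rmin_l]).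
  assert (Hh2 : Rabs h < eps / (M + 1)) by (eapply Rlt_le_trans; [exact Hh | apply Rmin_r]).
  assert (T := TaylorL (x + h)).
  replace (x + h - x) with h in T by ring. specialize (T ltac:(lra)).
  assert (Hp := Rabs_pos_lt h Hh0).
  replace ((f (x + h) - f x) / h - l) with ((f (x + h) - f x - l * h) / h) by (field; lra).
  rewrite Rabs_div by exact Hh0.
  apply Rle_lt_trans with (M * Rabs h).
  - apply (Rmult_le_reg_r (Rabs h)); [lra|].
    unfold Rdiv; rewrite Rmult_assoc, Rinv_l, Rmult_1_r by lra.
    rewrite <- (pow2_abs h) in T. lra.
  - apply (Rmult_lt_compat_l (M + 1)) in Hh2; [|lra].
    replace ((M + 1) * (eps / (M + 1))) with eps in Hh2 by (field; lra). nra.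
Qed.

(* Complete monotonicity on [I] up to order [n]; keeping the order finite makes the closure
   properties below plain inductions on [n]. *)
Fixpoint cm (n : nat) (I : R -> Prop) (f : R -> R) : Prop :=
  (forall x, I x -> 0 <= f x) /\
  match n with
  | O => True
  | S m => (forall x, I x -> ex_derive f x) /\ cm m I (fun x => - Derive f x)
  end.

Lemma cm_nonneg n I f x : cm n I f -> I x -> 0 <= f x.
Proof. destruct n; intros [H _]; apply H. Qed.

(** Openness of [I] turns equality on [I] into equality near each point, so the derivatives agree as
    well. *)
Lemma cm_ext n I f g :
  open I -> (forall x, I x -> f x = g x) -> cm n I f -> cm n I g.
Proof.
  intros HI. revert f g; induction n as [|n IH]; intros f g Hfg [H0 H]; split.
  - intros x Hx; rewrite <- Hfg; auto.
  - exact Logic.I.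
  - intros x Hx; rewrite <- Hfg; auto.
  - destruct H as [Hd H]; split.
    + intros x Hx. apply (ex_derive_ext_loc f); [|auto].
      apply (filter_imp I); auto.
    + apply (IH (fun x => - Derive f x)); [|exact H].
      intros x Hx; f_equal. apply Derive_ext_loc. apply (filter_imp I); auto.
Qed.

(** Introduction rule with [g] as an explicit formula for [- f']; it keeps [Derive] out of concrete
    computations. *)
Lemma cm_S n I f g :
  open I -> (forall x, I x -> 0 <= f x) ->
  (forall x, I x -> is_derive f x (- g x)) -> cm n I g -> cm (S n) I f.
Proof.
  intros HI H0 Hd Hg. split; [exact H0|split].
  - intros x Hx; eexists; apply Hd, Hx.
  - apply (cm_ext n I g); [exact HI| |exact Hg].
    intros x Hx. rewrite (is_derive_unique _ _ _ (Hd x Hx)); ring.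
Qed.

Lemma cm_Derive n I f : cm (S n) I f -> cm n I (fun x => - Derive f x).
Proof. intros H; apply H. Qed.

Lemma cm_pred n I f : cm (S n) I f -> cm n I f.
Proof.
  revert f; induction n as [|n IH]; intros f [H0 [Hd H]]; split; auto.
Qed.

Lemma cm_subset n (I J : R -> Prop) f :
  (forall x, J x -> I x) -> cm n I f -> cm n J f.
Proof.
  intros HIJ; revert f; induction n as [|n IH]; intros f [H0 H]; split; auto.
  destruct H as [Hd H]; split; auto.
Qed.

Lemma cm_const n I c : open I -> 0 <= c -> cm n I (fun _ => c).
Proof.
  intros HI; revert c; induction n as [|n IH]; intros c Hc.
  - split; auto.
  - apply (cm_S n I _ (fun _ => 0)); auto.
    + intros x _. rewrite Ropp_0. apply (is_derive_const c x).
    + apply IH; lra.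
Qed.

Lemma cm_plus n I f g :
  open I -> cm n I f -> cm n I g -> cm n I (fun x => f x + g x).
Proof.
  intros HI; revert f g; induction n as [|n IH]; intros f g Hf Hg.
  - split; auto. intros x Hx.
    assert (0 <= f x) by (apply (cm_nonneg 0 I); auto).
    assert (0 <= g x) by (apply (cm_nonneg 0 I); auto). lra.
  - apply (cm_S n I _ (fun x => - Derive f x + - Derive g x)); auto.
    + intros x Hx. apply Rplus_le_le_0_compat; eapply cm_nonneg; eassumption.
    + intros x Hx. destruct Hf as [_ [Hf _]], Hg as [_ [Hg _]].
      replace (- (- Derive f x + - Derive g x)) with (Derive f x + Derive g x) by ring.
      apply (is_derive_plus f g); apply Derive_correct; auto.
    + apply IH; [apply Hf | apply Hg].
Qed.

(** Leibniz rule: [- (f g)' = (- f') g + f (- g')], and each summand is a product covered by the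
    induction hypothesis. *)
Lemma cm_mult n I f g :
  open I -> cm n I f -> cm n I g -> cm n I (fun x => f x * g x).
Proof.
  intros HI; revert f g; induction n as [|n IH]; intros f g Hf Hg.
  - split; auto. intros x Hx.
    apply Rmult_le_pos; [apply (cm_nonneg 0 I f) | apply (cm_nonneg 0 I g)]; auto.
  - apply (cm_S n I _ (fun x => (- Derive f x) * g x + f x * (- Derive g x))); auto.
    + intros x Hx. apply Rmult_le_pos; eapply cm_nonneg; eassumption.
    + intros x Hx. destruct Hf as [_ [Hf _]], Hg as [_ [Hg _]].
      auto_derive; [auto|].
      change (Derive (fun y => f y)) with (Derive f).
      change (Derive (fun y => g y)) with (Derive g). ring.
    + apply cm_plus; [exact HI| |]; apply IH;
        first [apply cm_pred; assumption | apply Hf | apply Hg].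
Qed.

(** Here [- (exp f)' = (- f') exp f], so the claim at order [n] and [cm_mult] give order [S n]. *)
Lemma cm_exp n I f :
  open I -> cm n I f -> cm n I (fun x => exp (f x)).
Proof.
  intros HI; induction n as [|n IH]; intros Hf.
  - split; auto. intros x _; apply Rlt_le, exp_pos.
  - apply (cm_S n I _ (fun x => (- Derive f x) * exp (f x))); auto.
    + intros x _; apply Rlt_le, exp_pos.
    + intros x Hx. destruct Hf as [_ [Hf _]]. auto_derive; [auto|].
      change (Derive (fun y => f y)) with (Derive f). ring.
    + apply cm_mult; [exact HI | apply Hf | apply IH, cm_pred, Hf].
Qed.

Lemma open_pos : open (fun x => 0 < x).
Proof. apply open_gt. Qed.

Lemma cm_shift n f k :
  0 <= k -> cm n (fun x => 0 < x) f -> cm n (fun x => 0 < x) (fun x => f (x + k)).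
Proof.
  intros Hk; revert f; induction n as [|n IH]; intros f Hf.
  - split; auto. intros x Hx. apply (cm_nonneg 0 (fun x => 0 < x) f); [exact Hf | lra].
  - apply (cm_S n _ _ (fun x => - Derive f (x + k))).
    + apply open_pos.
    + intros x Hx. apply (cm_nonneg (S n) (fun x => 0 < x) f); [exact Hf | lra].
    + intros x Hx. destruct Hf as [_ [Hf _]].
      auto_derive; [apply Hf; lra|].
      change (Derive (fun y => f y)) with (Derive f). ring.
    + apply (IH (fun x => - Derive f x)), Hf.
Qed.

(** The negated derivative is the square of the function itself, so the induction closes by
    [cm_mult]. *)
Lemma cm_inv_shift n c : 0 <= c -> cm n (fun x => 0 < x) (fun x => / (x + c)).
Proof.
  intros Hc; induction n as [|n IH].
  - split; auto. intros x Hx; apply Rlt_le, Rinv_0_lt_compat; lra.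
  - apply (cm_S n _ _ (fun x => / (x + c) * / (x + c))).
    + apply open_pos.
    + intros x Hx; apply Rlt_le, Rinv_0_lt_compat; lra.
    + intros x Hx. auto_derive; [lra | field; lra].
    + apply cm_mult; auto using open_pos.
Qed.

Lemma cm_Derive_n n I f x :
  open I -> cm n I f -> I x -> ex_derive_n f n x /\ 0 <= (-1) ^ n * Derive_n f n x.
Proof.
  intros HI; revert f; induction n as [|n IH]; intros f Hf Hx.
  - split; [exact Logic.I|]. simpl. rewrite Rmult_1_l. apply (cm_nonneg 0 I f); auto.
  - destruct Hf as [_ [Hd Hf]]. destruct (IH _ Hf Hx) as [H1 H2].
    (* [Derive_n] differentiates on the outside, [cm] on the inside; [E] converts between the
       two. *)
    assert (E : forall m y, Derive_n f (S m) y = - Derive_n (fun z => - Derive f z) m y).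
    { intros m y. rewrite Derive_n_opp, Ropp_involutive.
      etransitivity; [|symmetry; apply (Derive_n_comp f m 1)]. f_equal; lia. }
    split.
    + destruct n as [|n]; [apply Hd, Hx|].
      apply (ex_derive_ext (fun y => - Derive_n (fun z => - Derive f z) n y)).
      { intros y; symmetry; apply E. }
      apply (ex_derive_opp (Derive_n (fun z => - Derive f z) n)), H1.
    + rewrite E. change ((-1) ^ S n) with (-1 * (-1) ^ n). lra.
Qed.

(** * Pointwise limits, and recovery of a function from its differences or its derivative *)

Lemma mean_value f f' a b :
  a < b -> (forall c, a <= c <= b -> is_derive f c (f' c)) ->
  exists c, f b - f a = f' c * (b - a) /\ a < c < b.
Proof.
  intros Hab H. apply MVT_cor2; [exact Hab|].
  intros c Hc; apply is_derive_Reals, H, Hc.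
Qed.

Lemma cm_nonincreasing f x y :
  cm 1 (fun x => 0 < x) f -> 0 < x <= y -> f y <= f x.
Proof.
  intros Hf [Hx [Hxy | ->]]; [|lra].
  destruct (mean_value f (Derive f) x y Hxy) as [c [E Hc]].
  { intros c Hc; apply Derive_correct, Hf; lra. }
  assert (H := cm_nonneg _ _ _ c (cm_Derive _ _ _ Hf) ltac:(lra)). simpl in H. nra.
Qed.

(** By the mean value theorem [f (x - d) - f x = d * (- f' c)] with [c < x]; moreover [- f'] is
    nonincreasing and [f x >= 0]. *)
Lemma cm_derive_bound f x d :
  0 < d < x -> cm 2 (fun x => 0 < x) f -> - Derive f x <= f (x - d) / d.
Proof.
  intros Hd Hf.
  destruct (mean_value f (Derive f) (x - d) x) as [c [E Hc]]; [lra| |].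
  { intros c Hc; apply Derive_correct, Hf; lra. }
  assert (H := cm_nonincreasing _ c x (cm_Derive _ _ _ Hf) ltac:(lra)). simpl in H.
  assert (H0 := cm_nonneg _ _ _ x Hf ltac:(lra)).
  replace (x - (x - d)) with d in E by ring.
  apply (Rmult_le_reg_r d); [lra|].
  replace (f (x - d) / d * d) with (f (x - d)) by (field; lra). nra.
Qed.

(** Applied twice, [cm_derive_bound] controls second derivatives by values of the functions, which
    are bounded in [k] by convergence. Hence [derivative_of_limit] applies, and the induction passes
    to the negated derivatives. *)
Lemma cm_limit n (u : nat -> R -> R) (f : R -> R) :
  (forall k m, cm m (fun x => 0 < x) (u k)) ->
  (forall x, 0 < x -> is_lim_seq (fun k => u k x) (f x)) ->
  cm n (fun x => 0 < x) f.
Proof.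
  revert u f; induction n as [|n IH]; intros u f Hu Hf.
  - split; auto. intros x Hx.
    apply (is_lim_seq_le (fun _ => 0) (fun k => u k x) 0 (f x)).
    + intros k; apply (cm_nonneg 0 _ _ _ (Hu k 0%nat)), Hx.
    + apply is_lim_seq_const.
    + apply Hf, Hx.
  - assert (Hl : forall x, 0 < x ->
      is_lim_seq (fun k => Derive (u k) x) (Derive f x) /\ ex_derive f x).
    { intros x Hx. set (d := x / 8).
      assert (Hd : 0 < d) by (unfold d; lra).
      assert (Hxd : x = 8 * d) by (unfold d; lra).
      destruct (filterlim_bounded (V := R_NormedModule) (fun k => u k (2 * d))) as [B HB].
      { exists (f (2 * d)). apply Hf; lra. }
      assert (Hin : forall y, Rabs (y - x) <= d -> 7 * d <= y).
      { intros y Hy. apply Rabs_le_between in Hy. lra. }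
      destruct (derivative_of_limit u (fun k => Derive (u k))
        (fun k => Derive (Derive (u k))) f x d (B / d / d)) as [l [Hl1 Hl2]].
      - exact Hd.
      - intros k y Hy; apply Derive_correct, (Hu k 1%nat). apply Hin in Hy; lra.
      - intros k y Hy; apply Derive_correct. apply Hin in Hy.
        apply (ex_derive_ext (fun y => - - Derive (u k) y)).
        { intros t; apply Ropp_involutive. }
        apply (ex_derive_opp (fun y => - Derive (u k) y)), (Hu k 2%nat); lra.
      - intros k y Hy. apply Hin in Hy.
        assert (E : Derive (Derive (u k)) y = - Derive (fun z => - Derive (u k) z) y).
        { rewrite Derive_opp; ring. }
        assert (H0 : 0 <= Derive (Derive (u k)) y).
        { rewrite E.
          apply (cm_nonneg _ _ _ y (cm_Derive _ _ _ (cm_Derive _ _ _ (Hu k 2%nat)))); lra. }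
        rewrite Rabs_pos_eq, E by exact H0.
        eapply Rle_trans; [apply (cm_derive_bound _ y d); [lra|apply (Hu k 3%nat)]|].
        unfold Rdiv; apply Rmult_le_compat_r; [apply Rlt_le, Rinv_0_lt_compat, Hd|].
        eapply Rle_trans; [apply (cm_derive_bound _ (y - d) d); [lra|apply (Hu k 2%nat)]|].
        unfold Rdiv; apply Rmult_le_compat_r; [apply Rlt_le, Rinv_0_lt_compat, Hd|].
        eapply Rle_trans; [apply (cm_nonincreasing (u k) (2 * d)); [apply Hu|lra]|].
        eapply Rle_trans; [apply Rle_abs | apply HB].
      - intros y Hy. apply Hin in Hy. apply Hf; lra.
      - rewrite (is_derive_unique _ _ _ Hl2); split; [exact Hl1 | exists l; exact Hl2]. }
    split; [|split].
    + intros x Hx.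
      apply (is_lim_seq_le (fun _ => 0) (fun k => u k x) 0 (f x)).
      * intros k; apply (cm_nonneg 0 _ _ _ (Hu k 0%nat)), Hx.
      * apply is_lim_seq_const.
      * apply Hf, Hx.
    + intros x Hx; apply Hl, Hx.
    + apply (IH (fun k x => - Derive (u k) x)).
      * intros k m; apply (Hu k (S m)).
      * intros x Hx. apply (proj1 (is_lim_seq_opp _ (Derive f x))), Hl, Hx.
Qed.

(** Telescoping: [f x - f (x + k) + c] equals [c] plus the sum of [g (x + j)] for [j < k]. These
    functions are completely monotonic and converge to [f x]. *)
Lemma cm_of_difference (f g : R -> R) (c : R) :
  0 <= c -> (forall n, cm n (fun x => 0 < x) g) ->
  (forall x, 0 < x -> f x - f (x + 1) = g x) ->
  (forall x, 0 < x -> is_lim_seq (fun k => f (x + INR k)) c) ->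
  forall n, cm n (fun x => 0 < x) f.
Proof.
  intros Hc Hg Hfg Hf n.
  apply (cm_limit n (fun k x => f x - f (x + INR k) + c)).
  - intros k m; induction k as [|k IHk].
    + apply (cm_ext m _ (fun _ => c)); [apply open_pos| |apply cm_const; auto using open_pos].
      intros x _; simpl; rewrite Rplus_0_r; ring.
    + apply (cm_ext m _ (fun x => (f x - f (x + INR k) + c) + g (x + INR k)));
        [apply open_pos| |].
      * intros x Hx. assert (H := pos_INR k). rewrite <- Hfg by lra.
        rewrite S_INR.
        replace (x + (INR k + 1)) with (x + INR k + 1) by ring. ring.
      * apply cm_plus; [apply open_pos | exact IHk|].
        apply cm_shift; [apply pos_INR | apply Hg].
  - intros x Hx.
    replace (Finite (f x)) with (Finite (f x - c + c)) by (f_equal; ring).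
    apply is_lim_seq_plus'; [|apply is_lim_seq_const].
    apply is_lim_seq_minus'; [apply is_lim_seq_const | apply Hf, Hx].
Qed.

(** What remains is [f >= 0]: since [f' = - g <= 0], the values [f (x + k)] decrease to their limit
    0. *)
Lemma cm_of_derivative (f g : R -> R) :
  (forall n, cm n (fun x => 0 < x) g) ->
  (forall x, 0 < x -> is_derive f x (- g x)) ->
  (forall x, 0 < x -> is_lim_seq (fun k => f (x + INR k)) 0) ->
  forall n, cm n (fun x => 0 < x) f.
Proof.
  intros Hg Hd Hf n. apply cm_pred.
  apply (cm_S n _ f g); auto using open_pos.
  intros x Hx.
  assert (Hdec : forall k, f (x + INR (S k)) <= f (x + INR k)).
  { intros k. assert (H := pos_INR k). rewrite S_INR.
    destruct (mean_value f (fun y => - g y) (x + INR k) (x + (INR k + 1))) as [c [E Hc]];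
      [lra | intros c Hc; apply Hd; lra|].
    assert (H1 := cm_nonneg 0 _ _ c (Hg 0%nat) ltac:(lra)). nra. }
  replace (f x) with (f (x + INR 0)) by (simpl; f_equal; ring).
  apply (is_lim_seq_decr_compare (fun k => f (x + INR k)) 0); auto.
Qed.

(** * The gamma integral *)

Lemma filter_prod_pos (a0 b0 : R) :
  0 < a0 ->
  filter_prod (at_right 0) (Rbar_locally p_infty)
    (fun ab => 0 < fst ab < a0 /\ b0 < snd ab).
Proof.
  intros Ha.
  apply (Filter_prod _ _ _ (fun a => 0 < a < a0) (fun b => b0 < b)); [| |simpl; auto].
  - exists (mkposreal _ Ha). intros y Hy Hy0. apply AbsRing_norm_compat2 in Hy.
    unfold norm, minus, plus, opp in Hy; simpl in Hy. unfold abs in Hy; simpl in Hy.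
    apply Rabs_def2 in Hy. lra.
  - exists b0; auto.
Qed.

(** Monotone convergence: the supremum of the proper integrals is the improper one, since enlarging
    [[a0, b0]] only increases the integral. *)
Lemma ex_RInt_gen_nonneg (f : R -> R) (M : R) :
  (forall t, 0 < t -> continuous f t) ->
  (forall t, 0 < t -> 0 <= f t) ->
  (forall a b, 0 < a < b -> RInt f a b <= M) ->
  exists l : R, is_RInt_gen f (at_right 0) (Rbar_locally p_infty) l /\
    forall a b, 0 < a < b -> RInt f a b <= l.
Proof.
  intros Hc H0 HM.
  set (E := fun v => exists a b, 0 < a < b /\ v = RInt f a b).
  destruct (completeness E) as [l [Hl1 Hl2]].
  { exists M; intros v [a [b [Hab ->]]]; apply HM, Hab. }
  { exists (RInt f 1 2), 1, 2; split; [lra | reflexivity]. }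
  exists l. split; [|intros a b Hab; apply Hl1; exists a, b; auto].
  assert (Hex : forall a b, 0 < a -> a <= b -> ex_RInt f a b).
  { intros a b Ha Hab. apply (ex_RInt_continuous f). intros z Hz.
    rewrite Rmin_left, Rmax_right in Hz by lra. apply Hc; lra. }
  apply filterlimi_locally. intros eps. assert (He := cond_pos eps).
  assert (Hnear : exists a b, 0 < a < b /\ l - eps < RInt f a b).
  { apply Classical_Prop.NNPP; intros Hn.
    assert (l <= l - eps); [|lra].
    apply Hl2. intros v [a [b [Hab ->]]]. apply Rnot_lt_le. intros Hlt.
    apply Hn; exists a, b; auto. }
  destruct Hnear as [a0 [b0 [Hab0 Hnear]]].
  apply (filter_imp (fun ab => 0 < fst ab < a0 /\ b0 < snd ab));
    [|apply filter_prod_pos; lra].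
  intros [a b] [Ha Hb]; simpl in *. exists (RInt f a b). split.
  - apply (RInt_correct f), Hex; lra.
  - assert (Hle : RInt f a b <= l) by (apply Hl1; exists a, b; split; [lra | reflexivity]).
    assert (C1 : RInt f a a0 + RInt f a0 b = RInt f a b).
    { apply (RInt_Chasles f a a0 b); apply Hex; lra. }
    assert (C2 : RInt f a0 b0 + RInt f b0 b = RInt f a0 b).
    { apply (RInt_Chasles f a0 b0 b); apply Hex; lra. }
    assert (0 <= RInt f a a0).
    { apply RInt_ge_0; [lra | apply Hex; lra | intros t Ht; apply H0; lra]. }
    assert (0 <= RInt f b0 b).
    { apply RInt_ge_0; [lra | apply Hex; lra | intros t Ht; apply H0; lra]. }
    apply Rabs_def1; unfold minus, plus, opp; simpl; lra.
Qed.

Lemma exp_le_compat x y : x <= y -> exp x <= exp y.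
Proof. intros [H | ->]; [apply Rlt_le, exp_increasing, H | apply Rle_refl]. Qed.

Definition gamma_integrand (x t : R) : R := Rpower t (x - 1) * exp (- t).

Lemma gamma_integrand_pos x t : 0 < gamma_integrand x t.
Proof. apply Rmult_lt_0_compat; apply exp_pos. Qed.

Lemma gamma_integrand_continuous x t : 0 < t -> continuous (gamma_integrand x) t.
Proof.
  intros Ht. apply (ex_derive_continuous (gamma_integrand x)).
  unfold gamma_integrand, Rpower. auto_derive. exact Ht.
Qed.

(* The constant is the maximum of [exp (- t) (1 + t) ^ (x + 1)], attained at [t = x]. *)
Lemma exp_opp_le_power x t :
  0 < x -> 0 < t ->
  exp (- t) <= exp ((x + 1) * ln (x + 1) - x) * exp (- (x + 1) * ln (1 + t)).
Proof.
  intros Hx Ht. rewrite <- exp_plus.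
  apply exp_le_compat.
  assert (H : ln ((1 + t) / (x + 1)) <= (1 + t) / (x + 1) - 1).
  { assert (Hp : 0 < (1 + t) / (x + 1)) by (apply Rdiv_lt_0_compat; lra).
    assert (H := exp_ineq1_le (ln ((1 + t) / (x + 1)))).
    rewrite exp_ln in H by exact Hp. lra. }
  rewrite ln_div in H by lra.
  apply (Rmult_le_compat_l (x + 1)) in H; [|lra].
  replace ((x + 1) * ((1 + t) / (x + 1) - 1)) with (t - x) in H by (field; lra).
  lra.
Qed.

(* The integrand is dominated by a multiple of the derivative of [(t / (1 + t)) ^ x]. *)
Lemma gamma_integrand_RInt_le x a b :
  0 < x -> 0 < a < b ->
  RInt (gamma_integrand x) a b <= exp ((x + 1) * ln (x + 1) - x) / x.
Proof.
  intros Hx Hab. set (C := exp ((x + 1) * ln (x + 1) - x)).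
  assert (HC : 0 < C) by apply exp_pos.
  set (P := fun t => C / x * exp (x * (ln t - ln (1 + t)))).
  set (P' := fun t => C * (/ t - / (1 + t)) * exp (x * (ln t - ln (1 + t)))).
  assert (HP : is_RInt P' a b (minus (P b) (P a))).
  { apply (is_RInt_derive P P'); intros t Ht;
      rewrite Rmin_left, Rmax_right in Ht by lra.
    - unfold P, P'. auto_derive; [lra|]. unfold Rminus. field; lra.
    - apply (ex_derive_continuous P'). unfold P'. auto_derive.
      repeat split; lra. }
  apply Rle_trans with (RInt P' a b).
  - apply RInt_le; [lra | | exists (minus (P b) (P a)); exact HP|].
    + apply (ex_RInt_continuous (gamma_integrand x)). intros t Ht.
      rewrite Rmin_left, Rmax_right in Ht by lra.
      apply gamma_integrand_continuous; lra.
    + intros t Ht. unfold gamma_integrand, P', Rpower.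
      apply Rle_trans with (exp ((x - 1) * ln t) * (C * exp (- (x + 1) * ln (1 + t)))).
      { apply Rmult_le_compat_l; [apply Rlt_le, exp_pos|].
        apply exp_opp_le_power; lra. }
      apply Req_le.
      replace (/ t - / (1 + t)) with (/ t * / (1 + t)) by (field; lra).
      assert (Einv : forall s, 0 < s -> / s = exp (- ln s))
        by (intros s Hs; rewrite exp_Ropp, exp_ln by exact Hs; reflexivity).
      rewrite (Einv t), (Einv (1 + t)) by lra.
      replace (exp ((x - 1) * ln t) * (C * exp (- (x + 1) * ln (1 + t))))
        with (C * (exp ((x - 1) * ln t) * exp (- (x + 1) * ln (1 + t)))) by ring.
      rewrite Rmult_assoc, <- !exp_plus. f_equal. f_equal. ring.
  - rewrite (is_RInt_unique _ _ _ _ HP). unfold minus, plus, opp; simpl.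
    assert (0 < P a) by (apply Rmult_lt_0_compat; [apply Rdiv_lt_0_compat; lra | apply exp_pos]).
    assert (P b <= C / x * 1).
    { apply Rmult_le_compat_l; [apply Rlt_le, Rdiv_lt_0_compat; lra|].
      apply Rle_trans with (exp 0); [|rewrite exp_0; lra]. apply exp_le_compat.
      assert (ln b <= ln (1 + b)) by (apply ln_le; lra). nra. }
    lra.
Qed.

(** Positivity follows because the integral over [[1, 2]] is a positive lower bound. *)
Lemma is_RInt_gen_Gamma x :
  0 < x ->
  is_RInt_gen (gamma_integrand x) (at_right 0) (Rbar_locally p_infty) (Gamma x) /\
  0 < Gamma x.
Proof.
  intros Hx.
  destruct (ex_RInt_gen_nonneg (gamma_integrand x) (exp ((x + 1) * ln (x + 1) - x) / x))
    as [l [Hl Hle]].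
  - intros t; apply gamma_integrand_continuous.
  - intros t _; apply Rlt_le, gamma_integrand_pos.
  - intros a b; apply gamma_integrand_RInt_le, Hx.
  - assert (E : Gamma x = l) by exact (is_RInt_gen_unique _ _ Hl).
    rewrite E; split; [exact Hl|].
    apply Rlt_le_trans with (RInt (gamma_integrand x) 1 2); [|apply Hle; lra].
    apply RInt_gt_0; [lra | intros t _; apply gamma_integrand_pos|].
    intros t Ht; apply gamma_integrand_continuous; lra.
Qed.

Lemma Gamma_pos x : 0 < x -> 0 < Gamma x.
Proof. apply is_RInt_gen_Gamma. Qed.

Lemma Gamma_boundary_term_0 x :
  0 < x -> filterlim (fun t => Rpower t x * exp (- t)) (at_right 0) (locally 0).
Proof.
  intros Hx. apply filterlim_locally. intros eps. assert (He := cond_pos eps).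
  (* The radius is [eps] to the power [1 / x]: below it, [t ^ x < eps]. *)
  assert (Hd : 0 < exp (ln eps / x)) by apply exp_pos.
  exists (mkposreal _ Hd). intros t Ht Ht0.
  assert (Ht1 : t < exp (ln eps / x)).
  { unfold ball in Ht; simpl in Ht; unfold AbsRing_ball, abs, minus, plus, opp in Ht;
      simpl in Ht. apply Rabs_def2 in Ht; lra. }
  apply ln_increasing in Ht1; [|exact Ht0]. rewrite ln_exp in Ht1.
  apply (Rmult_lt_compat_l x) in Ht1; [|exact Hx].
  replace (x * (ln eps / x)) with (ln eps) in Ht1 by (field; lra).
  apply exp_increasing in Ht1. rewrite exp_ln in Ht1 by exact He.
  assert (H1 : exp (- t) < 1) by (rewrite <- exp_0; apply exp_increasing; lra).
  assert (H2 := exp_pos (- t)). assert (H3 := exp_pos (x * ln t)).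
  unfold ball; simpl; unfold AbsRing_ball, abs, minus, plus, opp; simpl. unfold Rpower.
  apply Rabs_def1; nra.
Qed.

Lemma Gamma_boundary_term_infty x :
  0 < x ->
  filterlim (fun t => Rpower t x * exp (- t)) (Rbar_locally p_infty) (locally 0).
Proof.
  intros Hx. apply filterlim_locally. intros eps. assert (He := cond_pos eps).
  set (C := exp ((x + 1) * ln (x + 1) - x)).
  assert (HC : 0 < C) by apply exp_pos.
  exists (C / eps). intros t Ht.
  assert (Ht0 : 0 < t)
    by (apply Rlt_trans with (C / eps); [apply Rdiv_lt_0_compat; assumption | exact Ht]).
  assert (H1 := exp_opp_le_power x t Hx Ht0). fold C in H1.
  (* Together with [H1] this bounds the boundary term by [C / t], which explains the threshold
     [C / eps]. *)
  assert (H2 : Rpower t x * exp (- (x + 1) * ln (1 + t)) <= / t).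
  { unfold Rpower. rewrite <- exp_plus.
    replace (/ t) with (exp (- ln t)) by (rewrite exp_Ropp, exp_ln by exact Ht0; reflexivity).
    apply exp_le_compat.
    assert (ln t <= ln (1 + t)) by (apply ln_le; lra). nra. }
  assert (H3 : C * / t < eps).
  { apply (Rmult_lt_reg_r t); [exact Ht0|]. rewrite Rmult_assoc, Rinv_l by lra.
    apply (Rmult_lt_compat_r eps) in Ht; [|exact He].
    replace (C / eps * eps) with C in Ht by (field; lra). lra. }
  assert (H4 : 0 < Rpower t x) by apply exp_pos.
  assert (H5 := exp_pos (- t)).
  unfold ball; simpl; unfold AbsRing_ball, abs, minus, plus, opp; simpl.
  apply Rabs_def1; nra.
Qed.

(** Integration by parts: the integral of the derivative of [t ^ x * exp (- t)] is computed from the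
    boundary values, both 0, and from the two gamma integrals. *)
Lemma Gamma_succ x : 0 < x -> Gamma (x + 1) = x * Gamma x.
Proof.
  intros Hx.
  set (F := fun t => Rpower t x * exp (- t)).
  assert (HF : forall t, 0 < t ->
    is_derive F t (x * gamma_integrand x t - gamma_integrand (x + 1) t)).
  { intros t Ht. unfold F, gamma_integrand, Rpower. auto_derive; [exact Ht|].
    replace ((x + 1 - 1) * ln t) with (x * ln t) by ring.
    replace ((x - 1) * ln t) with (x * ln t + - ln t) by ring.
    rewrite exp_plus, (exp_Ropp (ln t)), exp_ln by exact Ht. field; lra. }
  assert (Hin : filter_prod (at_right 0) (Rbar_locally p_infty)
    (fun ab => forall t, Rmin (fst ab) (snd ab) <= t <= Rmax (fst ab) (snd ab) -> 0 < t)).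
  { apply (filter_imp (fun ab => 0 < fst ab < 1 /\ 1 < snd ab));
      [|apply filter_prod_pos; lra].
    intros [a b] [Ha Hb] t; simpl in *. rewrite Rmin_left by lra. lra. }
  assert (H0 : is_RInt_gen (Derive F) (at_right 0) (Rbar_locally p_infty) (0 - 0)).
  { apply is_RInt_gen_Derive.
    - apply (filter_imp _ _ (fun ab H t Ht => ex_intro _ _ (HF t (H t Ht))) Hin).
    - refine (filter_imp _ _ _ Hin). intros ab H t Ht. specialize (H t Ht).
      apply (continuous_ext_loc _
        (fun t => x * gamma_integrand x t - gamma_integrand (x + 1) t)).
      + apply (filter_imp (fun t => 0 < t)); [|apply open_pos; exact H].
        intros s Hs; symmetry; apply is_derive_unique, HF, Hs.
      + apply (continuous_minus (fun t => x * gamma_integrand x t)).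
        * apply (continuous_scal_r x (gamma_integrand x)), gamma_integrand_continuous, H.
        * apply gamma_integrand_continuous, H.
    - apply Gamma_boundary_term_0, Hx.
    - apply Gamma_boundary_term_infty, Hx. }
  assert (H1 : is_RInt_gen (Derive F) (at_right 0) (Rbar_locally p_infty)
                 (x * Gamma x - Gamma (x + 1))).
  { apply (is_RInt_gen_ext
      (fun t => minus (scal x (gamma_integrand x t)) (gamma_integrand (x + 1) t))).
    - refine (filter_imp _ _ _ Hin). intros ab H t Ht.
      symmetry; apply is_derive_unique, HF, H; lra.
    - apply (is_RInt_gen_minus (fun t => scal x (gamma_integrand x t))).
      + apply (is_RInt_gen_scal (gamma_integrand x)), is_RInt_gen_Gamma, Hx.
      + apply is_RInt_gen_Gamma; lra. }
  assert (E0 : RInt_gen (Derive F) (at_right 0) (Rbar_locally p_infty) = 0 - 0)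
    by exact (is_RInt_gen_unique _ _ H0).
  assert (E1 : RInt_gen (Derive F) (at_right 0) (Rbar_locally p_infty)
                 = x * Gamma x - Gamma (x + 1)) by exact (is_RInt_gen_unique _ _ H1).
  lra.
Qed.

(** * Logarithmic convexity of the gamma function *)

Lemma exp_convex p q l :
  0 <= l <= 1 -> exp (l * p + (1 - l) * q) <= l * exp p + (1 - l) * exp q.
Proof.
  intros Hl. set (m := l * p + (1 - l) * q).
  assert (Hp : exp m * (1 + (p - m)) <= exp p).
  { replace p with (m + (p - m)) at 2 by ring. rewrite exp_plus.
    apply Rmult_le_compat_l; [apply Rlt_le, exp_pos | apply exp_ineq1_le]. }
  assert (Hq : exp m * (1 + (q - m)) <= exp q).
  { replace q with (m + (q - m)) at 2 by ring. rewrite exp_plus.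
    apply Rmult_le_compat_l; [apply Rlt_le, exp_pos | apply exp_ineq1_le]. }
  apply (Rmult_le_compat_l l) in Hp; [|lra].
  apply (Rmult_le_compat_l (1 - l)) in Hq; [|lra].
  (* Averaging the two tangent inequalities at [m] cancels the linear terms, because
     [l * (p - m) + (1 - l) * (q - m) = 0]. *)
  replace (exp m) with (l * (exp m * (1 + (p - m))) + (1 - l) * (exp m * (1 + (q - m))));
    [lra | unfold m; ring].
Qed.

(* Weighted AM-GM for the integrands, normalized to have integral 1. *)
Lemma ln_Gamma_convex x y l :
  0 < x -> 0 < y -> 0 <= l <= 1 ->
  ln (Gamma (l * x + (1 - l) * y)) <= l * ln (Gamma x) + (1 - l) * ln (Gamma y).
Proof.
  intros Hx Hy Hl. set (z := l * x + (1 - l) * y).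
  assert (Hz : 0 < z) by (unfold z; nra).
  assert (HGx := Gamma_pos x Hx). assert (HGy := Gamma_pos y Hy).
  assert (HGz := Gamma_pos z Hz).
  set (m := l * ln (Gamma x) + (1 - l) * ln (Gamma y)).
  (* The right side equals [l + (1 - l) = 1], so [H] says [exp (- m) * Gamma z <= 1], that is
     [ln (Gamma z) <= m]. *)
  assert (H : norm (scal (exp (- m)) (Gamma z)) <=
    plus (scal (l / Gamma x) (Gamma x)) (scal ((1 - l) / Gamma y) (Gamma y))).
  { apply (RInt_gen_norm (Fa := at_right 0) (Fb := Rbar_locally p_infty)
      (fun t => scal (exp (- m)) (gamma_integrand z t))
      (fun t => plus (scal (l / Gamma x) (gamma_integrand x t))
                     (scal ((1 - l) / Gamma y) (gamma_integrand y t)))).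
    - apply (filter_imp (fun ab => 0 < fst ab < 1 /\ 1 < snd ab));
        [intros ab H; lra | apply filter_prod_pos; lra].
    - apply (filter_imp (fun ab => 0 < fst ab < 1 /\ 1 < snd ab));
        [|apply filter_prod_pos; lra].
      intros ab Hab t Ht. unfold norm, scal, plus; simpl. unfold abs, mult; simpl.
      rewrite Rabs_pos_eq
        by (apply Rmult_le_pos; apply Rlt_le; [apply exp_pos | apply gamma_integrand_pos]).
      assert (Hc := exp_convex (- ln (Gamma x) + ((x - 1) * ln t + - t))
                      (- ln (Gamma y) + ((y - 1) * ln t + - t)) l Hl).
      rewrite (exp_plus (- ln (Gamma x))), (exp_plus (- ln (Gamma y))) in Hc.
      rewrite !exp_Ropp, !exp_ln, (exp_plus ((x - 1) * ln t)), (exp_plus ((y - 1) * ln t))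
        in Hc by assumption.
      unfold gamma_integrand, Rpower. unfold Rdiv. rewrite !Rmult_assoc.
      eapply Rle_trans; [apply Req_le | exact Hc].
      rewrite <- !exp_plus. f_equal. unfold m, z. ring.
    - apply (is_RInt_gen_scal (gamma_integrand z)), is_RInt_gen_Gamma, Hz.
    - apply (is_RInt_gen_plus (fun t => scal (l / Gamma x) (gamma_integrand x t)));
        apply (is_RInt_gen_scal (gamma_integrand _)), is_RInt_gen_Gamma; assumption. }
  unfold norm, scal, plus in H; simpl in H. unfold abs, mult in H; simpl in H.
  rewrite Rabs_pos_eq in H by (apply Rmult_le_pos; apply Rlt_le; [apply exp_pos | assumption]).
  replace (l / Gamma x * Gamma x + (1 - l) / Gamma y * Gamma y) with 1 in H by (field; lra).
  rewrite <- (exp_ln (Gamma z)), <- exp_plus, <- exp_0 in H by assumption.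
  apply Rnot_lt_le; intros Hlt. apply Rle_not_lt in H. apply H, exp_increasing. lra.
Qed.

(** * The digamma function *)

Lemma ln_le_sub1 y : 0 < y -> ln y <= y - 1.
Proof.
  intros Hy. assert (H := exp_ineq1_le (ln y)). rewrite exp_ln in H by exact Hy. lra.
Qed.

Lemma ln_sub_le x y : 0 < x -> 0 < y -> ln y - ln x <= (y - x) / x.
Proof.
  intros Hx Hy. rewrite <- ln_div by assumption.
  replace ((y - x) / x) with (y / x - 1) by (field; lra).
  apply ln_le_sub1, Rdiv_lt_0_compat; assumption.
Qed.

Lemma is_lim_seq_inv_shift x : is_lim_seq (fun k => / (x + INR k)) 0.
Proof.
  apply (is_lim_seq_inv _ p_infty); [|discriminate].
  apply (is_lim_seq_plus _ _ x p_infty);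
    [apply is_lim_seq_const | apply is_lim_seq_INR | reflexivity].
Qed.

(** The tangent inequality [ln_sub_le], used at each of the two points, squeezes the difference
    between multiples of inverses tending to 0. *)
Lemma is_lim_seq_ln_shift x a b :
  0 < x -> 0 <= a -> 0 <= b ->
  is_lim_seq (fun k => ln (x + INR k + a) - ln (x + INR k + b)) 0.
Proof.
  intros Hx Ha Hb.
  apply (is_lim_seq_le_le (fun k => (a - b) * / (x + a + INR k)) _
           (fun k => (a - b) * / (x + b + INR k))).
  - intros k. assert (Hk := pos_INR k). split.
    + assert (H := ln_sub_le (x + INR k + a) (x + INR k + b) ltac:(lra) ltac:(lra)).
      replace (x + a + INR k) with (x + INR k + a) by ring.
      replace ((x + INR k + b - (x + INR k + a)) / (x + INR k + a))
        with (- ((a - b) * / (x + INR k + a))) in H by (field; lra).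
      lra.
    + assert (H := ln_sub_le (x + INR k + b) (x + INR k + a) ltac:(lra) ltac:(lra)).
      replace (x + b + INR k) with (x + INR k + b) by ring.
      replace ((x + INR k + a - (x + INR k + b)) / (x + INR k + b))
        with ((a - b) * / (x + INR k + b)) in H by (field; lra).
      lra.
  - replace (Finite 0) with (Finite ((a - b) * 0)) by (f_equal; ring).
    apply is_lim_seq_mult'; [apply is_lim_seq_const | apply is_lim_seq_inv_shift].
  - replace (Finite 0) with (Finite ((a - b) * 0)) by (f_equal; ring).
    apply is_lim_seq_mult'; [apply is_lim_seq_const | apply is_lim_seq_inv_shift].
Qed.

Lemma ln_Gamma_succ x : 0 < x -> ln (Gamma (x + 1)) = ln (Gamma x) + ln x.
Proof.
  intros Hx. rewrite Gamma_succ, ln_mult by auto using Gamma_pos. ring.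
Qed.

(** Convexity in the form of increasing chord slopes, cleared of denominators. *)
Lemma ln_Gamma_slopes a b c :
  0 < a < b -> b < c ->
  (ln (Gamma b) - ln (Gamma a)) * (c - b) <= (ln (Gamma c) - ln (Gamma b)) * (b - a).
Proof.
  intros Ha Hc.
  assert (Hl : 0 <= (c - b) / (c - a) <= 1).
  { split; [apply Rlt_le, Rdiv_lt_0_compat; lra|].
    apply (Rmult_le_reg_r (c - a)); [lra|].
    unfold Rdiv; rewrite Rmult_assoc, Rinv_l; lra. }
  assert (H := ln_Gamma_convex a c _ ltac:(lra) ltac:(lra) Hl).
  replace ((c - b) / (c - a) * a + (1 - (c - b) / (c - a)) * c) with b in H by (field; lra).
  apply (Rmult_le_compat_l (c - a)) in H; [|lra].
  replace ((c - a) * ((c - b) / (c - a) * ln (Gamma a)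
                       + (1 - (c - b) / (c - a)) * ln (Gamma c)))
    with ((c - b) * ln (Gamma a) + (b - a) * ln (Gamma c)) in H by (field; lra).
  lra.
Qed.

Lemma ln_Gamma_add_n x n :
  0 < x -> ln (Gamma (x + INR n + 1)) = ln (Gamma x) + sum_n (fun k => ln (x + INR k)) n.
Proof.
  intros Hx; induction n as [|n IH].
  - rewrite sum_O. simpl. rewrite Rplus_0_r. apply ln_Gamma_succ, Hx.
  - assert (Hn := pos_INR n). rewrite sum_Sn, S_INR.
    rewrite ln_Gamma_succ by lra.
    replace (x + (INR n + 1)) with (x + INR n + 1) by ring.
    rewrite IH. unfold plus; simpl. ring.
Qed.

(* Euler's product for [Gamma], in logarithmic form; the index [S m] keeps [ln n] meaningful. *)
Definition euler_ln_Gamma (m : nat) (x : R) : R :=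
  ln (Gamma (INR (S m) + 1)) + x * ln (INR (S m)) - sum_n (fun k => ln (x + INR k)) (S m).

(** With [n = S m], comparing chord slopes places [ln (Gamma (x + n + 1)) - ln (Gamma (n + 1))]
    between [x * ln n] ([H1]) and [x * ln (x + n + 1)] ([H2]); the gap tends to 0. *)
Lemma is_lim_seq_euler_ln_Gamma x :
  0 < x -> is_lim_seq (fun m => euler_ln_Gamma m x) (ln (Gamma x)).
Proof.
  intros Hx.
  apply (is_lim_seq_le_le
           (fun m => ln (Gamma x) - x * (ln (1 + INR m + (1 + x)) - ln (1 + INR m + 0)))
           _ (fun _ => ln (Gamma x))).
  - intros m. assert (Hm := pos_INR m). unfold euler_ln_Gamma.
    assert (E := ln_Gamma_add_n x (S m) Hx).
    rewrite S_INR in *.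
    assert (H1 := ln_Gamma_slopes (INR m + 1) (INR m + 1 + 1) (x + (INR m + 1) + 1)
                    ltac:(lra) ltac:(lra)).
    assert (H2 := ln_Gamma_slopes (INR m + 1 + 1) (x + (INR m + 1) + 1)
                    (x + (INR m + 1) + 1 + 1) ltac:(lra) ltac:(lra)).
    rewrite (ln_Gamma_succ (INR m + 1)) in H1 by lra.
    rewrite (ln_Gamma_succ (x + (INR m + 1) + 1)) in H2 by lra.
    replace (1 + INR m + (1 + x)) with (x + (INR m + 1) + 1) by ring.
    replace (1 + INR m + 0) with (INR m + 1) by ring.
    rewrite (ln_Gamma_succ (INR m + 1)) in H2 |- * by lra.
    split; nra.
  - replace (Finite (ln (Gamma x))) with (Finite (ln (Gamma x) - x * 0)) by (f_equal; ring).
    apply is_lim_seq_minus'; [apply is_lim_seq_const|].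
    apply is_lim_seq_mult'; [apply is_lim_seq_const|].
    apply is_lim_seq_ln_shift; lra.
  - apply is_lim_seq_const.
Qed.

(** Each new term is at most [/ (y + n) - / (y + n + 1)], which telescopes. The resulting bound on
    the second derivatives of [euler_ln_Gamma] is uniform in the index. *)
Lemma sum_n_inv_sq_le y n :
  0 < y -> 0 <= sum_n (fun k => / (y + INR k) ^ 2) n <= / y ^ 2 + / y - / (y + INR n).
Proof.
  intros Hy. induction n as [|n IH].
  - rewrite sum_O. simpl INR. rewrite Rplus_0_r.
    assert (0 < / y ^ 2) by (apply Rinv_0_lt_compat, pow_lt, Hy). lra.
  - assert (Hn := pos_INR n). rewrite sum_Sn, S_INR.
    change (@plus R_AbelianMonoid) with Rplus.
    assert (H0 : 0 < / (y + (INR n + 1)) ^ 2) by (apply Rinv_0_lt_compat, pow_lt; lra).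
    assert (H : / (y + (INR n + 1)) ^ 2 <= / (y + INR n) - / (y + (INR n + 1))).
    { replace (/ (y + INR n) - / (y + (INR n + 1)))
        with (/ ((y + INR n) * (y + (INR n + 1)))) by (field; lra).
      apply Rinv_le_contravar; nra. }
    lra.
Qed.

(** [derivative_of_limit] is applied to [euler_ln_Gamma] within [x / 2] of [x], where all arguments
    are at least [x / 2]. *)
Lemma ln_Gamma_derive x :
  0 < x -> is_derive (fun y => ln (Gamma y)) x (digamma x) /\
  is_lim_seq (fun m => ln (INR (S m)) - sum_n (fun k => / (x + INR k)) (S m)) (digamma x).
Proof.
  intros Hx.
  assert (Hin : forall y, Rabs (y - x) <= x / 2 -> x / 2 <= y).
  { intros y Hy. apply Rabs_le_between in Hy. lra. }
  destruct (derivative_of_limit euler_ln_Gamma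
    (fun m y => ln (INR (S m)) - sum_n (fun k => / (y + INR k)) (S m))
    (fun m y => sum_n (fun k => / (y + INR k) ^ 2) (S m))
    (fun y => ln (Gamma y)) x (x / 2) (/ (x / 2) ^ 2 + / (x / 2))) as [l [Hl Hd]].
  - lra.
  - intros m y Hy. apply Hin in Hy.
    apply (is_derive_minus (fun y => ln (Gamma (INR (S m) + 1)) + y * ln (INR (S m)))).
    + generalize (ln (INR (S m))) (ln (Gamma (INR (S m) + 1))); intros c c'.
      auto_derive; [auto | ring].
    + apply (is_derive_sum_n (fun k y => ln (y + INR k)) _ _ (fun k => / (y + INR k))).
      intros k _. assert (Hk := pos_INR k). auto_derive; [lra | field; lra].
  - intros m y Hy. apply Hin in Hy.
    evar_last.
    { apply (is_derive_minus (fun y => ln (INR (S m)))); [apply is_derive_const|].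
      apply (is_derive_sum_n (fun k y => / (y + INR k)) _ _
               (fun k => - / (y + INR k) ^ 2)).
      intros k _. assert (Hk := pos_INR k). auto_derive; [lra | field; lra]. }
    transitivity (0 + - sum_n (fun k => - / (y + INR k) ^ 2) (S m)); [reflexivity|].
    rewrite (sum_n_ext _ (fun k => mult (-1) (/ (y + INR k) ^ 2)))
      by (intros k; unfold mult; simpl; ring).
    rewrite (sum_n_mult_l (K := R_Ring)).
    change (0 + - (-1 * sum_n (fun k => / (y + INR k) ^ 2) (S m))
            = sum_n (fun k => / (y + INR k) ^ 2) (S m)). ring.
  - intros m y Hy. apply Hin in Hy.
    assert (H := sum_n_inv_sq_le y (S m) ltac:(lra)).
    rewrite Rabs_pos_eq by apply H. destruct H as [_ H].
    assert (Hm := pos_INR (S m)).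
    assert (0 < / (y + INR (S m))) by (apply Rinv_0_lt_compat; lra).
    assert (/ y <= / (x / 2)) by (apply Rinv_le_contravar; lra).
    assert (/ y ^ 2 <= / (x / 2) ^ 2).
    { apply Rinv_le_contravar; [apply pow_lt; lra | apply pow_incr; lra]. }
    lra.
  - intros y Hy. apply Hin in Hy. apply is_lim_seq_euler_ln_Gamma; lra.
  (* Differentiability of [Gamma] itself comes from [Gamma = exp (ln Gamma)], which gives
     [Gamma' = l * Gamma]. *)
  - assert (E : digamma x = l).
    { unfold digamma. assert (HG := Gamma_pos x Hx).
      replace (Derive Gamma x) with (l * Gamma x); [field; lra|].
      symmetry; apply is_derive_unique.
      apply (is_derive_ext_loc (fun y => exp (ln (Gamma y)))).
      - apply (filter_imp (fun y => 0 < y)); [|apply open_pos, Hx].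
        intros y Hy; apply exp_ln, Gamma_pos, Hy.
      - rewrite <- (exp_ln (Gamma x)) by exact HG.
        apply (is_derive_comp exp (fun y => ln (Gamma y))); [apply is_derive_exp | exact Hd]. }
    rewrite E; split; assumption.
Qed.

Lemma digamma_nondecreasing x y : 0 < x <= y -> digamma x <= digamma y.
Proof.
  intros Hxy.
  apply (is_lim_seq_le _ _ (digamma x) (digamma y)) with
    (2 := proj2 (ln_Gamma_derive x ltac:(lra))) (3 := proj2 (ln_Gamma_derive y ltac:(lra))).
  intros m. apply Rplus_le_compat_l, Ropp_le_contravar.
  induction (S m) as [|n IH].
  - rewrite !sum_O. assert (H := pos_INR 0). apply Rinv_le_contravar; lra.
  - rewrite !sum_Sn. assert (H := pos_INR (S n)).
    apply Rplus_le_compat; [exact IH|]. apply Rinv_le_contravar; lra.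
Qed.

(** [ln (Gamma (y + 1))] is differentiated by the chain rule and through the functional equation. *)
Lemma digamma_succ x : 0 < x -> digamma (x + 1) = digamma x + / x.
Proof.
  intros Hx.
  assert (H1 : is_derive (fun y => ln (Gamma (y + 1))) x (digamma (x + 1))).
  { evar_last.
    - apply (is_derive_comp (fun y => ln (Gamma y)) (fun y => y + 1) x).
      + apply ln_Gamma_derive; lra.
      + auto_derive; [auto | reflexivity].
    - unfold scal; simpl; unfold mult; simpl; ring. }
  assert (H2 : is_derive (fun y => ln (Gamma (y + 1))) x (digamma x + / x)).
  { apply (is_derive_ext_loc (fun y => ln (Gamma y) + ln y)).
    - apply (filter_imp (fun y => 0 < y)); [|apply open_pos, Hx].
      intros y Hy; symmetry; apply ln_Gamma_succ, Hy.
    - apply (is_derive_plus (fun y => ln (Gamma y)));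
        [apply ln_Gamma_derive, Hx | apply is_derive_ln, Hx]. }
  apply is_derive_unique in H1. apply is_derive_unique in H2. congruence.
Qed.

(** By the mean value theorem [ln x = ln (Gamma (x + 1)) - ln (Gamma x)] is [digamma c] for some [c]
    between [x] and [x + 1]. *)
Lemma digamma_ln_bounds x : 0 < x -> digamma x <= ln x <= digamma (x + 1).
Proof.
  intros Hx.
  destruct (mean_value (fun y => ln (Gamma y)) digamma x (x + 1)) as [c [E Hc]]; [lra| |].
  { intros c Hc; apply ln_Gamma_derive; lra. }
  rewrite ln_Gamma_succ in E by exact Hx.
  replace (ln x) with (digamma c) by lra.
  split; apply digamma_nondecreasing; lra.
Qed.

Lemma is_lim_seq_ln_sub_digamma x :
  0 < x -> is_lim_seq (fun k => ln (x + INR k) - digamma (x + INR k)) 0.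
Proof.
  (* After the index shift, [digamma (x + k + 1)] has the lower bound [ln (x + k)]. *)
  intros Hx. apply is_lim_seq_incr_1.
  apply (is_lim_seq_le_le (fun _ => 0) _ (fun k => ln (x + INR k + 1) - ln (x + INR k + 0))).
  - intros k. assert (Hk := pos_INR k). rewrite S_INR.
    assert (H1 := digamma_ln_bounds (x + INR k) ltac:(lra)).
    assert (H2 := digamma_ln_bounds (x + INR k + 1) ltac:(lra)).
    replace (x + (INR k + 1)) with (x + INR k + 1) by ring. rewrite Rplus_0_r. lra.
  - apply is_lim_seq_const.
  - apply is_lim_seq_ln_shift; lra.
Qed.

(** * Asymptotics of [ln x - digamma x] and complete monotonicity of [x * (ln x - digamma x)] *)

Lemma cm_inv n : cm n (fun x => 0 < x) Rinv.
Proof.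
  apply (cm_ext n _ (fun x => / (x + 0))); [apply open_pos| |apply cm_inv_shift; lra].
  intros x _; rewrite Rplus_0_r; reflexivity.
Qed.

Ltac cm_tac := repeat first
  [ apply open_pos | apply cm_inv | apply cm_inv_shift; lra | apply cm_const; [|lra]
  | apply (cm_mult _ _ (fun x => _) (fun x => _)) ].

Lemma ln_sub_digamma_ge x : 0 < x -> / (2 * x) <= ln x - digamma x.
Proof.
  (* [K] is the difference [f x - f (x + 1)] of [f x = ln x - digamma x - / (2 * x)]; it is the
     trapezoidal error for the integral of [/ t] over [[x, x + 1]]. *)
  set (K := fun x => (/ x + / (x + 1)) / 2 + ln x - ln (x + 1)).
  assert (HK : forall n, cm n (fun x => 0 < x) K).
  { apply (cm_of_derivative K
      (fun x => / 2 * ((/ x * / (x + 1)) * (/ x * / (x + 1))))).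
    - intros n. cm_tac.
    - intros y Hy. unfold K. auto_derive; [lra | field; lra].
    - intros y Hy. unfold K.
      apply (is_lim_seq_ext (fun k => (/ (y + INR k) + / (y + 1 + INR k)) / 2
        + (ln (y + INR k + 0) - ln (y + INR k + 1)))).
      { intros k. replace (y + 1 + INR k) with (y + INR k + 1) by ring.
        rewrite Rplus_0_r. ring. }
      replace (Finite 0) with (Finite ((0 + 0) / 2 + 0)) by (f_equal; field).
      apply is_lim_seq_plus'; [|apply is_lim_seq_ln_shift; lra].
      apply is_lim_seq_mult'; [|apply is_lim_seq_const].
      apply is_lim_seq_plus'; apply is_lim_seq_inv_shift. }
  intros Hx.
  assert (H := cm_of_difference (fun x => ln x - digamma x - / 2 * / x) K 0
                 ltac:(lra) HK).
  assert (0 <= ln x - digamma x - / 2 * / x); [|rewrite Rinv_mult; lra].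
  apply (cm_nonneg 0 (fun x => 0 < x) (fun x => ln x - digamma x - / 2 * / x)); [|exact Hx].
  apply H.
  - intros y Hy. rewrite digamma_succ by exact Hy. unfold K. field; lra.
  - intros y Hy. replace (Finite 0) with (Finite (0 - / 2 * 0)) by (f_equal; ring).
    apply is_lim_seq_minus'; [apply is_lim_seq_ln_sub_digamma, Hy|].
    apply is_lim_seq_mult'; [apply is_lim_seq_const | apply is_lim_seq_inv_shift].
Qed.

Lemma ln_sub_digamma_le x : 0 < x -> ln x - digamma x <= / (2 * x) + / (12 * x ^ 2).
Proof.
  (* Again a first difference, now of the function [f] set below. The coefficient [/ 12] cancels the
     quadratic term of the derivative, leaving [- K' = / 6 * (/ (x * (x + 1))) ^ 3]. *)
  set (K := fun x => (/ x ^ 2 - / (x + 1) ^ 2) / 12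
              - (/ x + / (x + 1)) / 2 - ln x + ln (x + 1)).
  assert (HK : forall n, cm n (fun x => 0 < x) K).
  { apply (cm_of_derivative K
      (fun x => / 6 * ((/ x * / (x + 1)) * ((/ x * / (x + 1)) * (/ x * / (x + 1)))))).
    - intros n. cm_tac.
    - intros y Hy. unfold K. auto_derive; [repeat split; nra | field; lra].
    - intros y Hy. unfold K.
      apply (is_lim_seq_ext (fun k =>
        (/ (y + INR k) * / (y + INR k) - / (y + 1 + INR k) * / (y + 1 + INR k)) / 12
        - (/ (y + INR k) + / (y + 1 + INR k)) / 2
        + (ln (y + INR k + 1) - ln (y + INR k + 0)))).
      { intros k. assert (Hk := pos_INR k).
        replace (y + 1 + INR k) with (y + INR k + 1) by ring.
        rewrite Rplus_0_r. field; lra. }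
      replace (Finite 0) with (Finite ((0 * 0 - 0 * 0) / 12 - (0 + 0) / 2 + 0))
        by (f_equal; field).
      apply is_lim_seq_plus'; [|apply is_lim_seq_ln_shift; lra].
      apply is_lim_seq_minus'; (apply is_lim_seq_mult'; [|apply is_lim_seq_const]).
      + apply is_lim_seq_minus'; apply is_lim_seq_mult'; apply is_lim_seq_inv_shift.
      + apply is_lim_seq_plus'; apply is_lim_seq_inv_shift. }
  intros Hx.
  set (f := fun x => / 2 * / x + / 12 * (/ x * / x) - (ln x - digamma x)).
  assert (0 <= f x).
  { apply (cm_nonneg 0 (fun x => 0 < x) f); [|exact Hx].
    apply (cm_of_difference f K 0 ltac:(lra) HK).
    - intros y Hy. unfold f, K. rewrite digamma_succ by exact Hy. field; lra.
    - intros y Hy. unfold f.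
      replace (Finite 0) with (Finite (/ 2 * 0 + / 12 * (0 * 0) - 0)) by (f_equal; ring).
      apply is_lim_seq_minus'; [|apply is_lim_seq_ln_sub_digamma, Hy].
      apply is_lim_seq_plus'; (apply is_lim_seq_mult'; [apply is_lim_seq_const|]);
        [|apply is_lim_seq_mult']; apply is_lim_seq_inv_shift. }
  unfold f in *.
  replace (/ (2 * x) + / (12 * x ^ 2)) with (/ 2 * / x + / 12 * (/ x * / x)) by (field; lra).
  lra.
Qed.

(** Multiplying the two previous bounds by the argument [y] gives [/ 2] from below and
    [/ 2 + / (12 * y)] from above. *)
Lemma is_lim_seq_mul_ln_sub_digamma x :
  0 < x ->
  is_lim_seq (fun k => (x + INR k) * (ln (x + INR k) - digamma (x + INR k))) (/ 2).
Proof.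
  intros Hx.
  apply (is_lim_seq_le_le (fun _ => / 2) _ (fun k => / 2 + / 12 * / (x + INR k))).
  - intros k. assert (Hk := pos_INR k).
    assert (Hp : 0 < x + INR k) by lra.
    assert (H1 := ln_sub_digamma_ge _ Hp). assert (H2 := ln_sub_digamma_le _ Hp).
    apply (Rmult_le_compat_l (x + INR k)) in H1; [|lra].
    apply (Rmult_le_compat_l (x + INR k)) in H2; [|lra].
    replace ((x + INR k) * / (2 * (x + INR k))) with (/ 2) in H1 by (field; lra).
    replace ((x + INR k) * (/ (2 * (x + INR k)) + / (12 * (x + INR k) ^ 2)))
      with (/ 2 + / 12 * / (x + INR k)) in H2 by (field; lra).
    lra.
  - apply is_lim_seq_const.
  - replace (Finite (/ 2)) with (Finite (/ 2 + / 12 * 0)) by (f_equal; ring).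
    apply is_lim_seq_plus'; [apply is_lim_seq_const|].
    apply is_lim_seq_mult'; [apply is_lim_seq_const | apply is_lim_seq_inv_shift].
Qed.

(* [w] is the second difference of [h], and [v] is minus its derivative. *)
Lemma cm_mul_ln_sub_digamma n : cm n (fun x => 0 < x) (fun x => x * (ln x - digamma x)).
Proof.
  set (h := fun x => x * (ln x - digamma x)).
  set (w := fun x => - / (x + 1) + x * (ln x - ln (x + 1))
                     + (x + 2) * (ln (x + 2) - ln (x + 1))).
  set (v := fun x => 2 * ln (x + 1) - ln x - ln (x + 2) - / (x + 1) ^ 2).
  assert (Hlim : forall a x, 0 <= a -> 0 < x ->
            is_lim_seq (fun k => h (x + INR k + a)) (/ 2)).
  { intros a x Ha Hx. unfold h.
    apply (is_lim_seq_ext (fun k => (x + a + INR k) *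
      (ln (x + a + INR k) - digamma (x + a + INR k)))).
    - intros k. replace (x + a + INR k) with (x + INR k + a) by ring. reflexivity.
    - apply is_lim_seq_mul_ln_sub_digamma; lra. }
  assert (Ew : forall x, 0 < x -> (h x - h (x + 1)) - (h (x + 1) - h (x + 1 + 1)) = w x).
  { intros x Hx. unfold h, w. rewrite (digamma_succ (x + 1)), digamma_succ by lra.
    replace (x + 1 + 1) with (x + 2) by ring. field; lra. }
  assert (Hlim1 : forall x, 0 < x -> is_lim_seq (fun k => h (x + INR k) - h (x + INR k + 1)) 0).
  { intros x Hx. replace (Finite 0) with (Finite (/ 2 - / 2)) by (f_equal; ring).
    apply is_lim_seq_minus'; [|apply Hlim; lra].
    apply (is_lim_seq_ext (fun k => h (x + INR k + 0))); [|apply Hlim; lra].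
    intros k; rewrite Rplus_0_r; reflexivity. }
  assert (Hv : forall n, cm n (fun x => 0 < x) v).
  { apply (cm_of_derivative v (fun x => 2 * (/ x * / (x + 2)) *
      (/ (x + 1) * (/ (x + 1) * / (x + 1))))).
    - intros m. cm_tac.
    - intros x Hx. unfold v. auto_derive; [repeat split; nra | field; lra].
    - intros x Hx. unfold v.
      apply (is_lim_seq_ext (fun k =>
        (ln (x + INR k + 1) - ln (x + INR k + 0)) + (ln (x + INR k + 1) - ln (x + INR k + 2))
        - / (x + 1 + INR k) * / (x + 1 + INR k))).
      { intros k. assert (Hk := pos_INR k).
        replace (x + 1 + INR k) with (x + INR k + 1) by ring.
        rewrite Rplus_0_r. field; lra. }
      replace (Finite 0) with (Finite (0 + 0 - 0 * 0)) by (f_equal; ring).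
      apply is_lim_seq_minus'; [apply is_lim_seq_plus'; apply is_lim_seq_ln_shift; lra|].
      apply is_lim_seq_mult'; apply is_lim_seq_inv_shift. }
  assert (Hw : forall n, cm n (fun x => 0 < x) w).
  { apply (cm_of_derivative w v Hv).
    - intros x Hx. unfold w, v. auto_derive; [repeat split; lra | field; lra].
    - intros x Hx.
      (* The limit of [w] is read from [Ew]: both first differences of [h] tend to 0. *)
      apply (is_lim_seq_ext (fun k => (h (x + INR k) - h (x + INR k + 1))
        - (h (x + 1 + INR k) - h (x + 1 + INR k + 1)))).
      { intros k. assert (Hk := pos_INR k). rewrite <- Ew by lra.
        replace (x + 1 + INR k) with (x + INR k + 1) by ring. reflexivity. }
      replace (Finite 0) with (Finite (0 - 0)) by (f_equal; ring).
      apply is_lim_seq_minus'; apply Hlim1; lra. }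
  (* Two summations: [w] gives the first difference of [h], with limit 0, which in turn gives [h],
     with limit [/ 2]. *)
  revert n. apply (cm_of_difference h (fun x => h x - h (x + 1)) (/ 2)); [lra| |auto|].
  - apply (cm_of_difference _ w 0); [lra | exact Hw | exact Ew | exact Hlim1].
  - intros x Hx. apply is_lim_seq_mul_ln_sub_digamma, Hx.
Qed.

(** * The sign of the Euler-Mascheroni constant and the function [q] *)

Lemma ln_succ_le_harmonic n : ln (INR n + 1) <= sum_n_m (fun k => / INR k) 1 n.
Proof.
  induction n as [|n IH].
  - rewrite sum_n_m_zero by lia. simpl. rewrite Rplus_0_l, ln_1. apply Rle_refl.
  - assert (Hn := pos_INR n). rewrite sum_n_Sm by lia.
    rewrite S_INR.
    assert (H := ln_sub_le (INR n + 1) (INR n + 1 + 1) ltac:(lra) ltac:(lra)).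
    replace ((INR n + 1 + 1 - (INR n + 1)) / (INR n + 1)) with (/ (INR n + 1)) in H
      by (field; lra).
    unfold plus; simpl. lra.
Qed.

Lemma euler_gamma_nonneg : 0 <= euler_gamma.
Proof.
  unfold euler_gamma.
  assert (H : Rbar_le (Lim_seq (fun _ => 0))
    (Lim_seq (fun n => sum_n_m (fun k => / INR k) 1 n - ln (INR n)))).
  { apply Lim_seq_le_loc. exists 1%nat. intros n Hn.
    assert (H := ln_succ_le_harmonic n).
    assert (Hp : 0 < INR n) by (apply lt_0_INR; lia).
    assert (ln (INR n) <= ln (INR n + 1)) by (apply ln_le; lra). lra. }
  rewrite Lim_seq_const in H.
  (* [real] sends [p_infty] to 0, and [H] rules out [m_infty]. *)
  destruct (Lim_seq _); simpl in *; [exact H | apply Rle_refl | contradiction].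
Qed.

Lemma open_unit_interval : open (fun x => 0 < x < 1).
Proof. apply open_and; [apply open_gt | apply open_lt]. Qed.

(** The restriction to the unit interval serves the sign of [- ln x]; its negated derivative is
    [/ x]. *)
Lemma cm_opp_ln n : cm n (fun x => 0 < x < 1) (fun x => - ln x).
Proof.
  apply cm_pred. apply (cm_S n _ _ Rinv).
  - apply open_unit_interval.
  - intros x Hx. assert (H := ln_le_sub1 x ltac:(lra)). lra.
  - intros x Hx. auto_derive; lra.
  - apply (cm_subset n (fun x => 0 < x)); [intros x Hx; lra | apply cm_inv].
Qed.

Lemma cm_ln_q n :
  cm n (fun x => 0 < x < 1) (fun t => (t * (digamma t - ln t) - euler_gamma) * ln t).
Proof.
  apply (cm_ext n _ (fun t => (euler_gamma + t * (ln t - digamma t)) * - ln t)).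
  - apply open_unit_interval.
  - intros t _; ring.
  - apply (cm_mult n _ (fun t => euler_gamma + t * (ln t - digamma t)));
      [apply open_unit_interval| |apply cm_opp_ln].
    apply cm_plus; [apply open_unit_interval| |].
    + apply cm_const; [apply open_unit_interval | apply euler_gamma_nonneg].
    + apply (cm_subset n (fun x => 0 < x)); [intros x Hx; lra|].
      apply cm_mul_ln_sub_digamma.
Qed.

Theorem theorem2p2 : log_completely_monotonic q (Finite 0) (Finite 1).
Proof.
  repeat split.
  - intros x _. apply exp_pos.
  - intros n x Hx.
    apply (cm_Derive_n n (fun x => 0 < x < 1) q x); [apply open_unit_interval| |exact Hx].
    (* [Rpower] unfolds to the exponential of this product, so [q] itself is completely monotonic
       and has derivatives of every order. *)
    apply (cm_exp n _ (fun t => (t * (digamma t - ln t) - euler_gamma) * ln t));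
      [apply open_unit_interval | apply cm_ln_q].
  - intros n x _ Hx.
    (* [Rpower] is an exponential at every real [t], so [ln (q t)] equals the product on the whole
       line, as [Derive_n_ext] requires. *)
    rewrite (Derive_n_ext _ (fun t => (t * (digamma t - ln t) - euler_gamma) * ln t))
      by (intros t; apply ln_exp).
    apply (cm_Derive_n n (fun x => 0 < x < 1));
      [apply open_unit_interval | apply cm_ln_q | exact Hx].
Qed.
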